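(* Let $V$ be a vector space of dimension $n\ge1$ over $\Bbbk$ and let $\mathbf B$ be the coordinate algebra of the maximal Clifford space associated with $V$. The kernel of the epimorphism $\mathbf T(V)\to\mathbf B$ (from the tensor algebra of $V=\mathbf B_1$, induced by the multiplication of $\mathbf B$) is the two-sided ideal in $\mathbf T(V)$ generated by the subspace of cubic relations $$\mathrm R_3=\bigl\langle v_1\otimes v_2\otimes v_3+v_2\otimes v_1\otimes v_3-v_3\otimes v_2\otimes v_1-v_3\otimes v_1\otimes v_2\ \bigm|\ v_1,v_2,v_3\in V\bigr\rangle\subset V^{\otimes3}\cong\mathbf B_1^{\otimes 3}.$$
   Context: $\Bbbk$ is a field of characteristic zero. $\mathbb P(E)$ denotes the projective space of one-dimensional subspaces of $E$, so $H^0(\mathbb P(E),\mathcal O(1))=E^\vee$. Work on $\mathbb P(\mathrm{Sym}^2V^\vee)$. Let $\mathbf q\colon \mathrm{Sym}^2V\otimes\mathcal O\to\mathcal O(1)$ be the tautological epimorphism; write $\mathbf q(v,w)$ for the image of $v\cdot w$. For $i\in\mathbb Z$ set $\mathcal C\ell_i=\bigoplus_{s\in\mathbb Z}\bigwedge^{i-2s}V\otimes\mathcal O(s)$ (with $\bigwedge^jV=0$ unless $0\le j\le n$). Clifford multiplication is the associative $\mathcal O$-bilinear product $\mathcal C\ell_i\otimes\mathcal C\ell_j\to\mathcal C\ell_{i+j}$ with unit $1\in\bigwedge^0V\otimes\mathcal O$ determined by $$v\cdot(w_1\wedge\dots\wedge w_m)=v\wedge w_1\wedge\dots\wedge w_m+\sum_{t=1}^m(-1)^{t-1}\mathbf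 q(v,w_t)\,w_1\wedge\dots\wedge\widehat{w_t}\wedge\dots\wedge w_m .$$ The maximal Clifford space is $(\mathbb P(\mathrm{Sym}^2V^\vee),\mathcal C\ell_0)$, and its coordinate algebra is the graded algebra $\mathbf B=\bigoplus_{i\ge0}\mathbf B_i$, $\mathbf B_i=\mathrm{Hom}_{\mathcal C\ell_0}(\mathcal C\ell_0,\mathcal C\ell_i)=H^0(\mathbb P(\mathrm{Sym}^2V^\vee),\mathcal C\ell_i)$, with product induced by Clifford multiplication. One has $\mathbf B_0=\Bbbk$, $\mathbf B_1=V$. The natural homomorphism $\mathbf T(V)=\mathbf T(\mathbf B_1)\to\mathbf B$ is surjective. *)

(* Defs.v *)
From HB Require Import structures.
From mathcomp Require Import all_boot all_order all_algebra.
From mathcomp Require Import boolp ring.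
From mathcomp Require Import monalg.
From mathcomp Require Import mpoly.

Set Implicit Arguments.
Unset Strict Implicit.
Unset Printing Implicit Defensive.

Import GRing.Theory.
Local Open Scope ring_scope.

Section ExteriorAlgebra.
Context {R : comNzRingType} {n : nat}.

(* The exterior algebra of R^n: [x J] is the coefficient of x on the wedge
   product e_J of the e_j, j \in J, taken in increasing order. *)
Definition ext : Type := {ffun {set 'I_n} -> R^o}.
HB.instance Definition _ := GRing.Lmodule.copy ext {ffun {set 'I_n} -> R^o}.

Implicit Types (i j : 'I_n) (J : {set 'I_n}) (x y : ext).

Definition ext_basis J : ext := [ffun I => (I == J)%:R].
Definition ext_sign i J : R := (-1) ^+ #|[set j in J | (j < i)%N]|.
(* e_i /\ x, and the interior product of x with the i-th dual basis vector. *)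
Definition ext_wedge i x : ext :=
  [ffun J : {set 'I_n} => if i \in J then ext_sign i J * x (J :\ i) else 0].
Definition ext_del i x : ext :=
  [ffun J : {set 'I_n} => if i \in J then 0 else ext_sign i J * x (i |: J)].

Lemma ext_wedge_linear i : linear (ext_wedge i).
Proof.
move=> a x y; apply/ffunP=> J; rewrite !ffunE; case: ifP => _.
  by rewrite mulrDr; congr (_ + _); rewrite /GRing.scale /= mulrCA.
by rewrite /GRing.scale /= mulr0 addr0.
Qed.
HB.instance Definition _ i :=
  GRing.isLinear.Build R ext ext _ (ext_wedge i) (ext_wedge_linear i).

Lemma ext_del_linear i : linear (ext_del i).
Proof.
move=> a x y; apply/ffunP=> J; rewrite !ffunE; case: ifP => _.
  by rewrite /GRing.scale /= mulr0 addr0.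
by rewrite mulrDr; congr (_ + _); rewrite /GRing.scale /= mulrCA.
Qed.
HB.instance Definition _ i :=
  GRing.isLinear.Build R ext ext _ (ext_del i) (ext_del_linear i).

Lemma ext_signU i j J : j \notin J ->
  ext_sign i (j |: J) = (if (j < i)%N then - ext_sign i J else ext_sign i J).
Proof.
move=> jJ; rewrite /ext_sign; case: ifP => ji.
  have -> : [set k in j |: J | (k < i)%N] = j |: [set k in J | (k < i)%N].
    by apply/setP=> k; rewrite !inE; case: eqP => // -> /=.
  by rewrite cardsU1 !inE (negPf jJ) /= exprS mulN1r.
congr (_ ^+ _); apply: eq_card => k; rewrite !inE.
by case: eqP => // ->; rewrite ji !andbF.
Qed.

Lemma ext_signD i j J : j \in J ->
  ext_sign i (J :\ j) = (if (j < i)%N then - ext_sign i J else ext_sign i J).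
Proof.
move=> jJ; rewrite -{2 3}(setD1K jJ) ext_signU ?setD11 //.
by case: (j < i)%N; rewrite ?opprK.
Qed.

Lemma ext_sign_sqr i J : ext_sign i J * ext_sign i J = 1.
Proof. by rewrite /ext_sign -expr2 -exprM mulnC exprM sqrrN !expr1n. Qed.

Lemma ltn_neg i j : i != j -> (i < j)%N = ~~ (j < i)%N.
Proof. by move=> h; rewrite -leqNgt ltn_neqAle h. Qed.

Lemma ext_wedge_anti i j x :
  ext_wedge i (ext_wedge j x) = - ext_wedge j (ext_wedge i x).
Proof.
apply/ffunP=> J; rewrite !ffunE !inE.
have [->|ij] := eqVneq i j.
  by rewrite ?eqxx /=; case: ifP; rewrite ?mulr0 oppr0.
case iJ: (i \in J); case jJ: (j \in J); rewrite ?andbF ?andbT ?mulr0 ?oppr0 //.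
rewrite ?[j == i]eq_sym ?ij /= !ext_signD // [(i < j)%N]ltn_neg // setDDl setUC -setDDl.
case: (j < i)%N => /=; rewrite ?mulNr ?mulrN ?mulNr ?opprK; by rewrite ?opprK [in LHS]mulrCA.
Qed.

Lemma ext_wedge_sqr i x : ext_wedge i (ext_wedge i x) = 0.
Proof.
by apply/ffunP=> J; rewrite !ffunE !inE eqxx /=; case: ifP; rewrite ?mulr0.
Qed.

Lemma ext_del_sqr i x : ext_del i (ext_del i x) = 0.
Proof.
by apply/ffunP=> J; rewrite !ffunE !inE eqxx /=; case: ifP; rewrite ?mulr0.
Qed.

Lemma ext_del_anti i j x :
  ext_del i (ext_del j x) = - ext_del j (ext_del i x).
Proof.
apply/ffunP=> J; rewrite !ffunE !inE.
have [->|ij] := eqVneq i j.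
  by rewrite ?eqxx /=; case: ifP; rewrite ?mulr0 oppr0.
rewrite ?[j == i]eq_sym ?(negPf ij) /=.
case iJ: (i \in J); case jJ: (j \in J); rewrite ?mulr0 ?oppr0 //.
rewrite !ext_signU ?iJ ?jJ // [(i < j)%N]ltn_neg // setUCA.
case: (j < i)%N => /=; rewrite ?mulNr ?mulrN ?mulNr ?opprK; by rewrite ?opprK [in LHS]mulrCA.
Qed.

Lemma ext_del_wedge i j x :
  ext_del i (ext_wedge j x) = (i == j)%:R *: x - ext_wedge j (ext_del i x).
Proof.
apply/ffunP=> J; rewrite !ffunE !inE.
have [->|ij] := eqVneq i j.
  rewrite /= /GRing.scale /= mul1r; case: ifP => iJ.
    by rewrite setD1K // mulrA ext_signD // ltnn ext_sign_sqr mul1r subrr.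
  by rewrite setU1K ?iJ // mulrA ext_signU ?iJ // ltnn ext_sign_sqr mul1r subr0.
rewrite ?[j == i]eq_sym ?(negPf ij) /= /GRing.scale /= mul0r add0r.
case iJ: (i \in J); case jJ: (j \in J); rewrite ?mulr0 ?oppr0 //.
rewrite ext_signU ?iJ // ext_signD // [(i < j)%N]ltn_neg //.
have -> : (i |: J) :\ j = i |: (J :\ j).
  by apply/setP=> k; rewrite !inE; case: eqP => // ->; rewrite ?[j == i]eq_sym ?(negPf ij).
case: (j < i)%N => /=; rewrite ?mulNr ?mulrN ?mulNr ?opprK; by rewrite ?opprK [in LHS]mulrCA.
Qed.

Lemma ext_del1 i : ext_del i (ext_basis set0) = 0.
Proof.
apply/ffunP=> J; rewrite !ffunE; case: ifP => // _.
have /negPf -> : i |: J != set0 by apply/set0Pn; exists i; rewrite setU11.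
by rewrite mulr0.
Qed.

Lemma ext_del_eq0 x : (forall i, ext_del i x = 0) -> x = x set0 *: ext_basis set0.
Proof.
move=> h; apply/ffunP=> J; rewrite !ffunE /GRing.scale /=.
have [->|/set0Pn[i iJ]] := eqVneq J set0; first by rewrite mulr1.
have /ffunP/(_ (J :\ i)) := h i; rewrite !ffunE setD11 setD1K //.
by move/(congr1 ( *%R (ext_sign i (J :\ i)))); rewrite mulrA ext_sign_sqr mul1r !mulr0.
Qed.

End ExteriorAlgebra.
Arguments ext : clear implicits.

Section CliffordProduct.
Context {R : comNzRingType} {n : nat} (q : 'I_n -> 'I_n -> R).
Local Notation E := (ext R n).
Local Notation wd := (@ext_wedge R n).
Local Notation del := (@ext_del R n).
Implicit Types (i j : 'I_n) (x y z : E) (s : seq 'I_n).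

Definition contr i x : E := \sum_j q i j *: ext_del j x.
Definition cliff_gen i x : E := ext_wedge i x + contr i x.

(* Write x = x0 + e_i /\ x1 with x0 and x1 free of e_i. Since
   e_i /\ x1 = e_i . x1 - contr i x1 for the Clifford product, we get
   x . y = (x0 - contr i x1) . y + e_i . (x1 . y), where x0 - contr i x1 and x1
   only involve the remaining basis vectors. The list s runs through the basis
   vectors that may still occur in x. The product obtained is associative and
   unital (cliff_mulA, cliff_mul1l, cliff_mul1r), bilinear (cliff_mulDl and
   following) and satisfies the defining formula of Clifford multiplication for
   arbitrary vectors v, w_1, ..., w_m (cliff_mul_wedge). *)
Fixpoint cliff_mul_rec (s : seq 'I_n) x y : E :=
  if s is i :: s' then
    let x1 := ext_del i x in
    cliff_mul_rec s' (x - ext_wedge i x1 - contr i x1) y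
    + cliff_gen i (cliff_mul_rec s' x1 y)
  else x set0 *: y.

Definition cliff_mul x y : E := cliff_mul_rec (enum 'I_n) x y.
Definition cliff_one : E := ext_basis set0.

Lemma contr_linear i : linear (contr i).
Proof.
move=> a x y; rewrite /contr scaler_sumr -big_split /=; apply: eq_bigr => j _.
by rewrite linearP scalerDr !scalerA mulrC.
Qed.
HB.instance Definition _ i :=
  GRing.isLinear.Build R E E _ (contr i) (contr_linear i).

Lemma cliff_gen_linear i : linear (cliff_gen i).
Proof. by move=> a x y; rewrite /cliff_gen !linearP addrACA scalerDr. Qed.
HB.instance Definition _ i :=
  GRing.isLinear.Build R E E _ (cliff_gen i) (cliff_gen_linear i).

Lemma cmrec_linearl s y : linear (fun x => cliff_mul_rec s x y).
Proof.
elim: s => [|i s IH] a x x' /=.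
  by rewrite !ffunE scalerDl scalerA.
set f := (fun x => cliff_mul_rec s x y) in IH *.
have IH' : forall a u v, cliff_mul_rec s (a *: u + v) y
   = a *: cliff_mul_rec s u y + cliff_mul_rec s v y by exact: IH.
rewrite !linearP /= IH' linearP scalerDr [RHS]addrACA -IH'.
congr (cliff_mul_rec _ _ _ + _).
move: (wd i _) (wd i _) (contr i _) (contr i _) => b c d e.
by apply/ffunP=> J; rewrite !ffunE /GRing.scale /=; ring.
Qed.

Lemma cmrec_linearr s x : linear (cliff_mul_rec s x).
Proof.
elim: s x => [|i s IH] x a y y' /=.
  by rewrite scalerDr !scalerA mulrC.
by rewrite !IH linearP scalerDr addrACA.
Qed.

Lemma contr_del i j x : contr i (del j x) = - del j (contr i x).
Proof.
rewrite /contr linear_sum -sumrN; apply: eq_bigr => l _.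
by rewrite linearZ /= ext_del_anti scalerN.
Qed.

Lemma contr_anti i j x : contr i (contr j x) = - contr j (contr i x).
Proof.
have -> : contr j (contr i x) = \sum_l q i l *: contr j (del l x).
  by rewrite [contr i x]/contr linear_sum; apply: eq_bigr => l _; rewrite linearZ.
rewrite -sumrN {1}/contr; apply: eq_bigr => l _.
by rewrite contr_del scalerN opprK.
Qed.

Lemma contr_sqr i x : contr i (contr i x) = 0.
Proof.
rewrite /contr; elim: (index_enum _) => [|j s IH]; first by rewrite big_nil.
rewrite !big_cons; set D := fun y => \sum_(l <- s) q i l *: del l y.
rewrite -/(D x); have -> u v : \sum_(l <- s) q i l *: del l (u + v) = D u + D v.
  by rewrite /D -big_split; apply: eq_bigr => l _; rewrite linearD scalerDr.
rewrite linearD scalerDr linearZ /= ext_del_sqr !scaler0 add0r [D (D x)]IH addr0.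
rewrite /D linear_sum scaler_sumr -big_split big1 // => l _ /=.
by rewrite !linearZ /= ext_del_anti !scalerN !scalerA mulrC addNr.
Qed.

Lemma contr_wedge i j x : contr i (wd j x) = q i j *: x - wd j (contr i x).
Proof.
rewrite /contr linear_sum -sumrN.
under eq_bigr => l _ do rewrite ext_del_wedge scalerBr scalerA.
rewrite big_split /=; congr (_ + _); last first.
  by apply: eq_bigr => l _; congr (- _); rewrite linearZ.
rewrite (bigD1 j) //= eqxx mulr1 big1 ?addr0 // => l /negPf ->.
by rewrite mulr0 scale0r.
Qed.

Lemma cliff_gen_del i j x : del i (cliff_gen j x) =
  (i == j)%:R *: x - cliff_gen j (del i x).
Proof.
by rewrite /cliff_gen linearD /= ext_del_wedge opprD contr_del opprK addrA.
Qed.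

Lemma contr_cliff_gen i j x :
  contr i (cliff_gen j x) = q i j *: x - cliff_gen j (contr i x).
Proof. by rewrite /cliff_gen linearD /= contr_wedge contr_anti opprD addrA. Qed.

Lemma cliff_gen_anti i j x : cliff_gen i (cliff_gen j x) =
  (q i j + q j i) *: x - cliff_gen j (cliff_gen i x).
Proof.
rewrite {1}/cliff_gen contr_cliff_gen /cliff_gen !linearD /=.
rewrite ext_wedge_anti (contr_wedge j i).
set a := wd j (wd i x); set b := wd i (contr j x); set c := wd j (contr i x).
set d := contr j (contr i x); move: a b c d => a b c d.
by apply/ffunP=> J; rewrite !ffunE /GRing.scale /=; ring.
Qed.

Definition supp s x := forall i, i \notin s -> del i x = 0.

Lemma supp_gen s j x : supp s x -> j \in s -> supp s (cliff_gen j x).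
Proof.
move=> hx js i iNs; rewrite cliff_gen_del hx // linear0 subr0.
by case: eqP iNs => [->|_]; rewrite ?js ?scale0r.
Qed.

Lemma supp_del i s x : supp (i :: s) x -> supp s (del i x).
Proof.
move=> hx l lNs; rewrite ext_del_anti; have [->|li] := eqVneq l i.
  by rewrite ext_del_sqr oppr0.
by rewrite hx ?linear0 ?oppr0 // inE negb_or li.
Qed.

Lemma supp_contr s i x : supp s x -> supp s (contr i x).
Proof. by move=> hx l ls; rewrite -[LHS]opprK -contr_del hx // linear0 oppr0. Qed.

Lemma supp_rest i s x : supp (i :: s) x ->
  supp s (x - wd i (del i x) - contr i (del i x)).
Proof.
move=> hx l lNs; rewrite !linearB /= (supp_contr i (supp_del hx)) ?subr0 //.
rewrite ext_del_wedge; have [->|li] := eqVneq l i.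
  by rewrite ext_del_sqr linear0 subr0 scale1r subrr.
rewrite scale0r sub0r opprK ext_del_anti hx ?inE ?negb_or ?li //.
by rewrite !linear0 ?oppr0 ?linear0 ?addr0.
Qed.

Notation rho := cliff_mul_rec.

Lemma rho_gen s x y j : supp s x -> j \in s ->
  rho s (cliff_gen j x) y = cliff_gen j (rho s x y).
Proof.
have rD s' u v y' : rho s' (u + v) y' = rho s' u y' + rho s' v y'.
  by have := cmrec_linearl s' y' 1 u v; rewrite !scale1r.
have r0 s' y' : rho s' 0 y' = 0.
  by have := rD s' 0 0 y'; rewrite addr0 -[LHS]addr0 => /addrI <-.
have rZ s' a u y' : rho s' (a *: u) y' = a *: rho s' u y'.
  by have := cmrec_linearl s' y' a u 0; rewrite /= r0 !addr0.
have rN s' u y' : rho s' (- u) y' = - rho s' u y'.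
  by rewrite -scaleN1r rZ scaleN1r.
elim: s x y j => [|i s IH] x y j //= hx.
have h1 := supp_del hx; have h0 := supp_rest hx.
set x1 := del i x in h0 h1 *; set x0 := x - wd i x1 - contr i x1 in h0 *.
have ex : x = x0 + cliff_gen i x1.
  by rewrite /x0 /cliff_gen; apply/ffunP=> J; rewrite !ffunE; ring.
have d0 : del i x0 = 0.
  rewrite /x0 !linearB /= ext_del_wedge eqxx scale1r /x1 ext_del_sqr linear0.
  by rewrite subr0 subrr -[del i _]opprK -contr_del ext_del_sqr linear0 oppr0 subr0.
have d1 : del i x1 = 0 by rewrite /x1 ext_del_sqr.
have key u v : del i u = 0 -> del i v = 0 ->
    rho s (u + cliff_gen i v - wd i (del i (u + cliff_gen i v))
       - contr i (del i (u + cliff_gen i v))) y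
    + cliff_gen i (rho s (del i (u + cliff_gen i v)) y)
    = rho s u y + cliff_gen i (rho s v y).
  move=> du dv; rewrite linearD /= du add0r cliff_gen_del eqxx dv linear0.
  rewrite scale1r subr0; congr (rho s _ y + _).
  by rewrite /cliff_gen; apply/ffunP=> J; rewrite !ffunE; ring.
rewrite inE; have [-> _|ji /= js] := eqVneq j i.
  have -> : cliff_gen i x = q i i *: x1 + cliff_gen i x0.
    rewrite ex linearD /= addrC; congr (_ + _); rewrite {1}/cliff_gen.
    rewrite contr_cliff_gen /cliff_gen !linearD /= ext_wedge_sqr contr_sqr.
    by apply/ffunP=> J; rewrite !ffunE; ring.
  rewrite key // ?linearZ /= ?d1 ?scaler0 // rZ [RHS]linearD /= addrC.
  congr (_ + _); rewrite -[LHS]addr0.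
  set w := rho s x1 y; rewrite /cliff_gen !linearD /= ext_wedge_sqr contr_sqr.
  by rewrite contr_wedge; apply/ffunP=> J; rewrite !ffunE; ring.
have -> : cliff_gen j x = (cliff_gen j x0 + (q i j + q j i) *: x1)
    + cliff_gen i (- cliff_gen j x1).
  by rewrite ex linearD /= (cliff_gen_anti j i) linearN /= addrA [q j i + _]addrC.
rewrite key; first last.
- by rewrite linearN /= cliff_gen_del d1 eq_sym (negPf ji) scale0r linear0 subr0 oppr0.
- rewrite linearD linearZ /= d1 scaler0 cliff_gen_del d0 linear0 eq_sym (negPf ji).
  by rewrite scale0r subr0 addr0.
rewrite rD rZ rN !IH // linearN /= (cliff_gen_anti i j).
by rewrite opprD opprK addrA addrK [RHS]linearD.
Qed.

Lemma supp_full x : supp (enum 'I_n) x.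
Proof. by move=> i; rewrite mem_enum. Qed.

Lemma cliff_mul_gen i x y :
  cliff_mul (cliff_gen i x) y = cliff_gen i (cliff_mul x y).
Proof. by apply: rho_gen; [apply: supp_full | rewrite mem_enum]. Qed.

Lemma cliff_mulDl : left_distributive cliff_mul +%R.
Proof.
move=> x y z; have := cmrec_linearl (enum 'I_n) z 1 x y.
by rewrite /= !scale1r.
Qed.

Lemma cliff_mulDr : right_distributive cliff_mul +%R.
Proof.
move=> z x y; have := cmrec_linearr (enum 'I_n) z 1 x y.
by rewrite !scale1r.
Qed.

Lemma cliff_mul0 y : cliff_mul 0 y = 0.
Proof. by have := cliff_mulDl 0 0 y; rewrite addr0 -[LHS]addr0 => /addrI <-. Qed.

Lemma cliff_mulr0 y : cliff_mul y 0 = 0.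
Proof. by have := cliff_mulDr y 0 0; rewrite addr0 -[LHS]addr0 => /addrI <-. Qed.

Lemma cliff_mulZl a x y : cliff_mul (a *: x) y = a *: cliff_mul x y.
Proof.
have := cmrec_linearl (enum 'I_n) y a x 0.
by rewrite /= -!/(cliff_mul _ _) cliff_mul0 !addr0.
Qed.

Lemma cliff_mulZr a x y : cliff_mul x (a *: y) = a *: cliff_mul x y.
Proof.
have := cmrec_linearr (enum 'I_n) x a y 0.
by rewrite -!/(cliff_mul _ _) cliff_mulr0 !addr0.
Qed.

Lemma cliff_mulA : associative cliff_mul.
Proof.
suff h s x y z : cliff_mul (rho s x y) z = rho s x (cliff_mul y z).
  by move=> x y z; symmetry; apply: h.
elim: s x => [|i s IH] x /=; first exact: cliff_mulZl.
by rewrite cliff_mulDl cliff_mul_gen !IH.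
Qed.

Lemma cliff_mul1l : left_id cliff_one cliff_mul.
Proof.
move=> y; rewrite /cliff_mul; elim: (enum _) => [|i s IH] /=.
  by rewrite ffunE eqxx scale1r.
rewrite ext_del1 !linear0 ?subr0 ?addr0 IH.
suff -> : rho s 0 y = 0 by rewrite linear0 addr0.
have := cmrec_linearl s y 1 0 0.
by rewrite /= !scale1r addr0 -[LHS]addr0 => /addrI <-.
Qed.

Lemma cliff_mul1r : right_id cliff_one cliff_mul.
Proof.
suff h s x : supp s x -> rho s x cliff_one = x by move=> x; apply/h/supp_full.
elim: s x => [|i s IH] x hx /=.
  by rewrite -ext_del_eq0 // => i; apply: hx.
rewrite IH ?IH; [|exact: supp_del|exact: supp_rest].
by rewrite /cliff_gen; apply/ffunP=> J; rewrite !ffunE; ring.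
Qed.

Lemma cliff_one_neq0 : cliff_one != 0.
Proof.
by apply/eqP=> /ffunP/(_ set0)/eqP; rewrite !ffunE eqxx oner_eq0.
Qed.
End CliffordProduct.

Section WedgeFormula.
Context {R : comNzRingType} {n : nat} (q : 'I_n -> 'I_n -> R).
Implicit Types (v w : 'rV[R]_n) (ws : seq 'rV[R]_n) (x y : ext R n).

Definition wedge_vec v x : ext R n := \sum_i v 0 i *: ext_wedge i x.
Definition wedge_seq ws : ext R n := foldr wedge_vec (ext_basis set0) ws.
Definition qform v w : R := \sum_i \sum_j v 0 i * w 0 j * q i j.
Definition contr_vec v x : ext R n := \sum_i v 0 i *: contr q i x.

Lemma contr_vec_wedge v w x :
  contr_vec v (wedge_vec w x) = qform v w *: x - wedge_vec w (contr_vec v x).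
Proof.
rewrite /contr_vec /wedge_vec /qform.
transitivity (\sum_i \sum_j ((v 0 i * w 0 j * q i j) *: x
  - (w 0 j * v 0 i) *: ext_wedge j (contr q i x))).
  apply: eq_bigr => i _.
  have -> : contr q i (\sum_j w 0 j *: ext_wedge j x) =
      \sum_j contr q i (w 0 j *: ext_wedge j x) by exact: raddf_sum.
  rewrite scaler_sumr; apply: eq_bigr => j _.
  have -> : contr q i (w 0 j *: ext_wedge j x) = w 0 j *: contr q i (ext_wedge j x).
    exact: linearZ.
  by rewrite contr_wedge !scalerBr !scalerA [w 0 j * v 0 i]mulrC.
under eq_bigr => i _ do rewrite big_split /=.
rewrite big_split /= scaler_suml; congr (_ + _).
  by apply: eq_bigr => i _; rewrite scaler_suml.
rewrite exchange_big /= -sumrN; apply: eq_bigr => j _.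
have -> : ext_wedge j (\sum_i v 0 i *: contr q i x) =
    \sum_i ext_wedge j (v 0 i *: contr q i x) by exact: raddf_sum.
rewrite scaler_sumr -sumrN; apply: eq_bigr => i _.
have -> : ext_wedge j (v 0 i *: contr q i x) = v 0 i *: ext_wedge j (contr q i x).
  exact: linearZ.
by rewrite scalerA.
Qed.

Lemma wedge_vec_linear v : linear (wedge_vec v).
Proof.
move=> a x y; rewrite /wedge_vec scaler_sumr -big_split; apply: eq_bigr => i _.
by rewrite linearP /= scalerDr !scalerA mulrC.
Qed.
HB.instance Definition _ v :=
  GRing.isLinear.Build R (ext R n) (ext R n) _ (wedge_vec v) (wedge_vec_linear v).

Lemma contr_vec_seq v ws : contr_vec v (wedge_seq ws) =
  \sum_(t < size ws) (-1) ^+ t *: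
    (qform v (nth 0 ws t) *: wedge_seq (take t ws ++ drop t.+1 ws)).
Proof.
elim: ws => [|w ws IH] /=.
  rewrite big_ord0 /contr_vec big1 // => i _.
  by rewrite /contr big1 ?scaler0 // => j _; rewrite ext_del1 scaler0.
rewrite contr_vec_wedge IH big_ord_recl /= scale1r drop0; congr (_ + _).
rewrite [wedge_vec w _]raddf_sum -sumrN; apply: eq_bigr => t _.
rewrite /bump /= !linearZ /= exprS mulN1r scaleNr.
by rewrite !scalerN !scalerA mulrC.
Qed.

Lemma cliff_mul_basis1 i x : cliff_mul q (ext_basis [set i]) x = cliff_gen q i x.
Proof.
have <- : cliff_gen q i cliff_one = ext_basis [set i].
  rewrite /cliff_gen [contr _ _ _]big1 ?addr0; last first.
    by move=> j _; rewrite ext_del1 scaler0.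
  apply/ffunP=> J; rewrite !ffunE; case: ifP => iJ; last first.
    by case: eqP => // JE; move: iJ; rewrite JE set11.
  have -> : (J :\ i == set0) = (J == [set i]).
    apply/eqP/eqP=> [h|->]; last by rewrite setDv.
    by rewrite -(setD1K iJ) h setU0.
  case: eqP => [->|_]; last by rewrite mulr0.
  rewrite mulr1 /ext_sign (_ : [set _ in _ | _] = set0) ?cards0 //.
  by apply/setP=> k; rewrite !inE; case: eqP => // ->; rewrite ltnn.
by rewrite cliff_mul_gen cliff_mul1l.
Qed.

Lemma cliff_mul_wedge v ws :
  cliff_mul q (\sum_i v 0 i *: ext_basis [set i]) (wedge_seq ws) =
  wedge_seq (v :: ws) + \sum_(t < size ws) (-1) ^+ t *:
    (qform v (nth 0 ws t) *: wedge_seq (take t ws ++ drop t.+1 ws)).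
Proof.
rewrite -contr_vec_seq /= /wedge_vec /contr_vec -big_split /=.
set W := wedge_seq ws.
transitivity (\sum_i v 0 i *: cliff_mul q (ext_basis [set i]) W).
  elim/big_ind2: _ => [|x y x' y' <- <-|i _]; first exact: cliff_mul0.
    exact: cliff_mulDl.
  exact: cliff_mulZl.
by apply: eq_bigr => i _; rewrite cliff_mul_basis1 /cliff_gen scalerDr.
Qed.

End WedgeFormula.

Section CliffordRing.
Context {R : comNzRingType} {n : nat} (q : 'I_n -> 'I_n -> R).

(* The argument q only serves to select the product. *)
Definition clifford : Type := let _ := q in ext R n.
HB.instance Definition _ := GRing.Lmodule.copy clifford (ext R n).
HB.instance Definition _ := GRing.Zmodule_isNzRing.Build clifford
  (cliff_mulA q) (cliff_mul1l q) (cliff_mul1r q)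
  (cliff_mulDl q) (cliff_mulDr q) cliff_one_neq0.
End CliffordRing.

Lemma fracD_common (F : fieldType) (u v x y : F) : x != 0 -> y != 0 ->
  u / x + v / y = (u * y + v * x) / (x * y).
Proof. by move=> x0 y0; field; rewrite x0 y0. Qed.

Section CliffordSpace.
Context (k : fieldType) (n : nat).

(* Unordered pairs {i, j}, i = j allowed: they index the basis e_i e_j of Sym^2 V,
   i.e. the homogeneous coordinates on P(Sym^2 V^dual), for V = k^n. *)
Definition sym2_index := {A : {set 'I_n} | (0 < #|A| <= 2)%N}.
HB.instance Definition _ := Finite.on sym2_index.

Lemma sym2_pairP (i j : 'I_n) : (0 < #|[set i; j]| <= 2)%N.
Proof. by rewrite cards2; case: (i != j). Qed.
Definition sym2_pair (i j : 'I_n) : sym2_index := exist _ [set i; j] (sym2_pairP i j).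

Definition coord_ring := mpoly #|{: sym2_index}| k.
HB.instance Definition _ := GRing.IntegralDomain.on coord_ring.
Definition coord_var (a : sym2_index) : coord_ring := 'X_(enum_rank a).
Definition fun_field := {fraction coord_ring}.
HB.instance Definition _ := GRing.Field.on fun_field.

Local Notation "x %:F" := (@FracField.tofrac coord_ring x).

(* Sections of O(s) over the standard open set where the coordinate a does not
   vanish, as a subset of the function field of the affine cone. *)
Definition O_local (a : sym2_index) (s : int) (f : fun_field) : Prop :=
  exists d m (g : coord_ring),
    [/\ g \is d.-homog, d%:Z = s + m%:Z & f = g%:F / (coord_var a)%:F ^+ m].

(* q(e_i, e_j), a section of O(1). *)
Definition q_taut (i j : 'I_n) : fun_field := (coord_var (sym2_pair i j))%:F.

(* The common ambient algebra of the sections of all the Cl_i: the fibre at the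
   generic point of the cone of the exterior algebra of V with its Clifford
   product. A section of Cl_i has its coefficient on e_I in O(s), i = #|I| + 2s. *)
Definition Cl_generic := clifford q_taut.
HB.instance Definition _ := GRing.NzRing.on Cl_generic.

Definition Cl_local (a : sym2_index) (i : int) (x : Cl_generic) : Prop :=
  forall I : {set 'I_n}, (x : ext fun_field n) I = 0 \/
    exists s : int, i = #|I|%:Z + 2 * s /\ O_local a s ((x : ext fun_field n) I).

(* Global sections: the standard open sets cover the (integral) projective space. *)
Definition H0_Cl (i : int) (x : Cl_generic) : Prop := forall a, Cl_local a i x.

(* Sums of elements of the H^0(Cl_i), i >= 0. The sum over i is direct when n > 0:
   on each e_I the summands are homogeneous fractions of distinct degrees. *)
Definition coord_alg_pred : {pred Cl_generic} := fun x =>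
  `[< exists (d : nat) (b : nat -> Cl_generic),
        (forall i : nat, H0_Cl i%:Z (b i)) /\ x = \sum_(i < d) b i >].

Lemma O_local_mul a s t f g :
  O_local a s f -> O_local a t g -> O_local a (s + t) (f * g).
Proof.
move=> [d [m [u [hu du ->]]]] [e [p [v [hv ev ->]]]].
exists (d + e)%N, (m + p)%N, (u * v); split; first exact: dhomogM.
  by rewrite !PoszD du ev addrACA.
by rewrite rmorphM exprD invfM mulrACA.
Qed.

Lemma coord_var_neq0 a : (coord_var a)%:F != 0.
Proof. by rewrite tofrac_eq0 -msupp_eq0 msuppX. Qed.

Lemma coord_var_homog a : coord_var a \is 1.-homog.
Proof. by rewrite /coord_var dhomogX /= mdeg1. Qed.

Lemma O_local_add a s f g : O_local a s f -> O_local a s g -> O_local a s (f + g).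
Proof.
move=> [d [m [u [hu du ->]]]] [e [p [v [hv ev ->]]]].
set X := coord_var a.
have X0 : X%:F != 0 := coord_var_neq0 a.
exists (d + p)%N, (m + p)%N, (u * X ^+ p + v * X ^+ m); split.
- have hX l : X ^+ l \is l.-homog.
    by have := dhomogMn l (coord_var_homog a); rewrite mul1n.
  apply: rpredD; first exact: dhomogM.
  have -> : (d + p = e + m)%N.
    by apply/eqP; rewrite -eqz_nat !PoszD du ev addrAC.
  exact: dhomogM.
- by rewrite !PoszD du addrA.
rewrite rmorphD !rmorphM !rmorphXn /= exprD.
have Xm : X%:F ^+ m != 0 by rewrite expf_neq0.
have Xp : X%:F ^+ p != 0 by rewrite expf_neq0.
exact: fracD_common.
Qed.

Lemma O_local_homog a d (g : coord_ring) : g \is d.-homog -> O_local a d%:Z g%:F.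
Proof. by exists d, 0%N, g; split; rewrite ?addr0 // expr0 divr1. Qed.


Lemma O_local0 a s : O_local a s 0.
Proof.
have [[m hm]|[m hm]] : (exists m : nat, s = m%:Z) \/ (exists m : nat, s = - m%:Z).
  by case: s => m; [left; exists m | right; exists m.+1].
- by exists m, 0%N, 0; split; rewrite ?rpred0 ?hm ?addr0 // rmorph0 mul0r.
- by exists 0%N, m, 0; split; rewrite ?rpred0 ?hm ?addNr // rmorph0 mul0r.
Qed.

Lemma O_localN1 a : O_local a 0 (-1).
Proof.
by have := @O_local_homog a 0 (-1); rewrite rmorphN1; apply; rewrite rpredN dhomog1.
Qed.

Lemma O_localN a s f : O_local a s f -> O_local a s (- f).
Proof. by move/(O_local_mul (O_localN1 a)); rewrite add0r mulN1r. Qed.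

Lemma O_local_const a c : O_local a 0 (mpolyC #|{: sym2_index}| c)%:F.
Proof. by apply: (@O_local_homog a 0); rewrite -[mpolyC _ _]mulr1 mul_mpolyC rpredZ ?dhomog1. Qed.

Lemma O_local_q a i j : O_local a 1 (q_taut i j).
Proof. exact/(@O_local_homog a 1)/coord_var_homog. Qed.

Lemma Cl_local0 a i : Cl_local a i 0.
Proof. by move=> I; left; rewrite ffunE. Qed.

Lemma Cl_localD a i (x y : Cl_generic) :
  Cl_local a i x -> Cl_local a i y -> Cl_local a i (x + y).
Proof.
move=> hx hy I; rewrite [(_ + _ : ext _ _) I]ffunE.
case: (hx I) => [->|[s [es hs]]]; first by rewrite add0r; exact: hy.
right; exists s; split => //; case: (hy I) => [->|[t [et ht]]].
  by rewrite addr0.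
suff st : s = t by apply: O_local_add => //; rewrite st.
have /mulfI := (isT : (2 : int) != 0); apply.
by apply: (@addrI _ #|I|%:Z); rewrite -es -et.
Qed.

Lemma Cl_localN a i (x : Cl_generic) : Cl_local a i x -> Cl_local a i (- x).
Proof.
move=> hx I; rewrite [(- _ : ext _ _) I]ffunE.
case: (hx I) => [->|[s [es hs]]]; first by left; rewrite oppr0.
by right; exists s; split => //; exact: O_localN.
Qed.

Lemma Cl_localZ a i s c (x : ext fun_field n) :
  O_local a s c -> Cl_local a i x -> Cl_local a (i + 2 * s) (c *: x).
Proof.
move=> hc hx I; rewrite [(_ *: _ : ext _ _) I]ffunE.
case: (hx I) => [->|[t [et ht]]]; first by left; rewrite /GRing.scale /= mulr0.
by right; exists (s + t); split; [rewrite et; ring | exact: O_local_mul].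
Qed.

Lemma O_local_sign a (j : 'I_n) (J : {set 'I_n}) : O_local a 0 (ext_sign j J).
Proof.
rewrite /ext_sign; elim: #|_| => [|m IH]; last first.
  by rewrite exprS -[0]addr0; exact: O_local_mul (O_localN1 a) IH.
by rewrite expr0 -[1]opprK; exact/O_localN/O_localN1.
Qed.

Lemma Cl_local_wedge a i j (x : ext fun_field n) :
  Cl_local a i x -> Cl_local a (i + 1) (ext_wedge j x).
Proof.
move=> hx I; rewrite [(ext_wedge _ _ : ext _ _) I]ffunE.
case: ifP => [jI|]; last by left.
case: (hx (I :\ j)) => [->|[s [es hs]]]; first by left; rewrite mulr0.
right; exists s; split; last by rewrite -[s]add0r; exact: O_local_mul (O_local_sign _ _ _) hs.
by rewrite es [in RHS](cardsD1 j I) jI add1n intS; ring.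
Qed.

Lemma Cl_local_del a i j (x : ext fun_field n) :
  Cl_local a i x -> Cl_local a (i - 1) (ext_del j x).
Proof.
move=> hx I; rewrite [(ext_del _ _ : ext _ _) I]ffunE.
case: ifP => [jI|jI]; first by left.
case: (hx (j |: I)) => [->|[s [es hs]]]; first by left; rewrite mulr0.
right; exists s; split; last by rewrite -[s]add0r; exact: O_local_mul (O_local_sign _ _ _) hs.
by rewrite es cardsU1 jI add1n intS; ring.
Qed.

Lemma Cl_local_contr a i j (x : ext fun_field n) :
  Cl_local a i x -> Cl_local a (i + 1) (contr q_taut j x).
Proof.
move=> hx; rewrite /contr; elim/big_ind: _ => [|y z|l _]; first exact: Cl_local0.
  exact: Cl_localD.
have -> : i + 1 = i - 1 + 2 * 1 by ring.
exact/Cl_localZ/Cl_local_del/hx/O_local_q.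
Qed.

Lemma Cl_local_gen a i j (x : ext fun_field n) :
  Cl_local a i x -> Cl_local a (i + 1) (cliff_gen q_taut j x).
Proof.
by move=> hx; apply: Cl_localD; [exact: Cl_local_wedge | exact: Cl_local_contr].
Qed.

Lemma Cl_local_mul a i j (x y : Cl_generic) :
  Cl_local a i x -> Cl_local a j y -> Cl_local a (i + j) (x * y).
Proof.
move=> + hy; rewrite /GRing.mul /= /cliff_mul.
elim: (enum _) i x => [|l s IH] i x hx /=.
  case: (hx set0) => [->|[s [es hs]]]; first by rewrite scale0r; exact: Cl_local0.
  by rewrite es cards0 add0r addrC; exact: Cl_localZ.
have h1 := Cl_local_del l hx.
have hw := Cl_local_wedge l h1; have hc := Cl_local_contr l h1.
rewrite subrK in hw hc.
apply: Cl_localD.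
  by apply: IH; apply: Cl_localD (Cl_localN hc); apply: Cl_localD (Cl_localN hw).
have -> : i + j = i - 1 + j + 1 by ring.
exact/Cl_local_gen/IH.
Qed.

Lemma Cl_local_basis a (J : {set 'I_n}) : Cl_local a #|J|%:Z (ext_basis J).
Proof.
move=> I; rewrite [(ext_basis _ : ext _ _) I]ffunE; case: eqP => [->|_]; last by left.
right; exists 0; rewrite mulr0 addr0; split=> //.
by rewrite -[_%:R]opprK; exact/O_localN/O_localN1.
Qed.

Lemma coord_alg_H0 (i : nat) x : H0_Cl i%:Z x -> x \in coord_alg_pred.
Proof.
move=> hx; apply/asboolP; exists i.+1, (fun j => if j == i then x else 0); split.
  by move=> j a; case: eqP => [->|_]; [exact: hx | exact: Cl_local0].
rewrite big_ord_recr /= eqxx big1 ?add0r // => j _.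
by rewrite ltn_eqF.
Qed.

Lemma coord_algD x y :
  x \in coord_alg_pred -> y \in coord_alg_pred -> x + y \in coord_alg_pred.
Proof.
move=> /asboolP[d [b [hb ->]]] /asboolP[e [c [hc ->]]]; apply/asboolP.
exists (d + e)%N, (fun i => (if (i < d)%N then b i else 0)
                     + (if (i < e)%N then c i else 0)); split.
  move=> i a; apply: Cl_localD; case: ifP => _; try exact: Cl_local0.
    exact: hb.
  exact: hc.
rewrite big_split /= -!big_mkcond /=; congr (_ + _).
  by rewrite (big_ord_widen _ b (leq_addr e d)).
by rewrite (big_ord_widen _ c (leq_addl d e)).
Qed.

Lemma coord_alg0 : 0 \in coord_alg_pred.
Proof. by apply: (@coord_alg_H0 0) => a; exact: Cl_local0. Qed.

Lemma coord_alg_sum (I : Type) (r : seq I) (F : I -> Cl_generic) :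
  (forall i, F i \in coord_alg_pred) -> \sum_(i <- r) F i \in coord_alg_pred.
Proof.
by move=> hF; elim/big_ind: _ => [|x y|i _]; [exact: coord_alg0|exact: coord_algD|].
Qed.

Lemma coord_alg_closed : subring_closed coord_alg_pred.
Proof.
split.
- apply: (@coord_alg_H0 0) => a.
  by have := Cl_local_basis a set0; rewrite cards0.
- move=> x y hx /asboolP[e [c [hc ->]]]; apply: coord_algD => //.
  rewrite -sumrN; apply: coord_alg_sum => i; apply: (@coord_alg_H0 i) => a.
  exact/Cl_localN/hc.
move=> x y /asboolP[d [b [hb ->]]] /asboolP[e [c [hc ->]]].
rewrite mulr_suml; apply: coord_alg_sum => i; rewrite mulr_sumr.
apply: coord_alg_sum => j; apply: (@coord_alg_H0 (i + j)) => a.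
by rewrite PoszD; apply: Cl_local_mul; [exact: hb | exact: hc].
Qed.
HB.instance Definition _ :=
  GRing.isSubringClosed.Build Cl_generic coord_alg_pred coord_alg_closed.

Definition coord_alg := {x : Cl_generic | x \in coord_alg_pred}.
HB.instance Definition _ := SubChoice.on coord_alg.
HB.instance Definition _ := [SubChoice_isSubNzRing of coord_alg by <:].

Definition const_frac (c : k) : fun_field := (mpolyC #|{: sym2_index}| c)%:F.

Lemma coord_alg_scaleP c (x : coord_alg) :
  (const_frac c *: (val x : ext _ _) : Cl_generic) \in coord_alg_pred.
Proof.
have [d [b [hb ->]]] := asboolW (valP x).
rewrite scaler_sumr; apply: coord_alg_sum => i; apply: (@coord_alg_H0 i) => a.
rewrite -[i%:Z]addr0 -[X in _ + X](mulr0 2); apply: Cl_localZ; last exact: hb.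
exact: O_local_const.
Qed.
Definition coord_alg_scale c (x : coord_alg) : coord_alg :=
  exist _ (const_frac c *: (val x : ext _ _) : Cl_generic) (coord_alg_scaleP c x).

Lemma coord_alg_scaleA a b x :
  coord_alg_scale a (coord_alg_scale b x) = coord_alg_scale (a * b) x.
Proof. by apply: val_inj; rewrite /= scalerA /const_frac !rmorphM. Qed.
Lemma coord_alg_scale1 : left_id 1 coord_alg_scale.
Proof. by move=> x; apply: val_inj; rewrite /= /const_frac !rmorph1 scale1r. Qed.
Lemma coord_alg_scaleDr : right_distributive coord_alg_scale +%R.
Proof. by move=> c x y; apply: val_inj; rewrite /= scalerDr. Qed.
Lemma coord_alg_scaleDl x : {morph coord_alg_scale^~ x : a b / a + b}.
Proof. by move=> a b; apply: val_inj; rewrite /= /const_frac !rmorphD scalerDl. Qed.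
HB.instance Definition _ := GRing.Zmodule_isLmodule.Build k coord_alg
  coord_alg_scaleA coord_alg_scale1 coord_alg_scaleDr coord_alg_scaleDl.

Lemma coord_alg_scaleAl c (x y : coord_alg) : c *: (x * y) = (c *: x) * y.
Proof. by apply: val_inj; rewrite /= [RHS]cliff_mulZl. Qed.
HB.instance Definition _ := GRing.Lmodule_isLalgebra.Build k coord_alg coord_alg_scaleAl.
Lemma coord_alg_scaleAr c (x y : coord_alg) : c *: (x * y) = x * (c *: y).
Proof. by apply: val_inj; rewrite /= [RHS]cliff_mulZr. Qed.
HB.instance Definition _ := GRing.Lalgebra_isAlgebra.Build k coord_alg coord_alg_scaleAr.

Lemma coord_genP (i : 'I_n) : (ext_basis [set i] : Cl_generic) \in coord_alg_pred.
Proof.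
by apply: (@coord_alg_H0 1) => a; have := Cl_local_basis a [set i]; rewrite cards1.
Qed.
Definition coord_gen i : coord_alg := exist _ (ext_basis [set i]) (coord_genP i).

End CliffordSpace.

Section TensorAlgebra.
Context (k : fieldType) (V : vectType k).
Local Notation n := (\dim {:V}).

(* T(V), as the free associative algebra on the basis [vbasis {:V}] of V. *)
Definition tensor_algebra := {malg k[{fmonom 'I_n}]}.
HB.instance Definition _ := GRing.Lalgebra.on tensor_algebra.

Definition tensor_incl (v : V) : tensor_algebra :=
  \sum_i coord (vbasis {:V}) i v *: mkmalgU (fmu i) 1.

Definition coord_algebra := coord_alg k n.
HB.instance Definition _ := GRing.Algebra.on coord_algebra.

(* The identification of V with B_1. *)
Definition coord_incl (v : V) : coord_algebra :=
  \sum_i coord (vbasis {:V}) i v *: coord_gen k i.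

Definition word_prod (w : {fmonom 'I_n}) : coord_algebra :=
  \prod_(i <- (w : seq _)) coord_gen k i.

Lemma word_prod_mmorphism : mmorphism word_prod.
Proof.
split; last by rewrite /word_prod fm1 big_nil.
by move=> u v; rewrite /word_prod fmM big_cat.
Qed.
HB.instance Definition _ :=
  isMultiplicative.Build _ _ word_prod word_prod_mmorphism.

(* The algebra morphism extending V = B_1 (see tensor_to_coord_incl). *)
Definition tensor_to_coord : tensor_algebra -> coord_algebra :=
  monalg.mmap (in_alg coord_algebra) word_prod.

Lemma tensor_to_coord_zmod : zmod_morphism tensor_to_coord.
Proof. by move=> x y; rewrite /tensor_to_coord raddfB. Qed.
HB.instance Definition _ := GRing.isZmodMorphism.Build
  tensor_algebra coord_algebra tensor_to_coord tensor_to_coord_zmod.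

Lemma tensor_to_coord_monoid : monoid_morphism tensor_to_coord.
Proof.
have [] := @monalg.commr_mmap_is_multiplicative _ _ _ (in_alg coord_algebra) word_prod.
  by move=> g m m'; rewrite /GRing.comm /= -scalerAl mul1r -scalerAr mulr1.
by split.
Qed.
HB.instance Definition _ := GRing.isMonoidMorphism.Build
  tensor_algebra coord_algebra tensor_to_coord tensor_to_coord_monoid.

Lemma tensor_to_coord_scalable : scalable tensor_to_coord.
Proof. by move=> c x; rewrite /tensor_to_coord monalg.mmapZ /= mulr_algl. Qed.
HB.instance Definition _ := GRing.isScalable.Build k
  tensor_algebra coord_algebra _ tensor_to_coord tensor_to_coord_scalable.

Lemma tensor_to_coord_incl v : tensor_to_coord (tensor_incl v) = coord_incl v.
Proof.
rewrite /tensor_incl linear_sum; apply: eq_bigr => i _; rewrite linearZ /=.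
by rewrite /tensor_to_coord monalg.mmapU /= scale1r mul1r /word_prod fmU big_seq1.
Qed.

Definition cubic_relation (v1 v2 v3 : V) : tensor_algebra :=
  tensor_incl v1 * tensor_incl v2 * tensor_incl v3
  + tensor_incl v2 * tensor_incl v1 * tensor_incl v3
  - tensor_incl v3 * tensor_incl v2 * tensor_incl v1
  - tensor_incl v3 * tensor_incl v1 * tensor_incl v2.

Definition R3 (r : tensor_algebra) : Prop :=
  exists s : seq (k * (V * V * V)),
    r = \sum_(c <- s) c.1 *: cubic_relation c.2.1.1 c.2.1.2 c.2.2.

End TensorAlgebra.

Definition two_sided_ideal (A : pzRingType) (J : A -> Prop) : Prop :=
  [/\ J 0, forall x y, J x -> J y -> J (x - y)
    & forall a x b, J x -> J (a * x * b)].

Definition generated_ideal (A : pzRingType) (S : A -> Prop) (t : A) : Prop :=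
  forall J : A -> Prop, two_sided_ideal J -> (forall r, S r -> J r) -> J t.

(* Main.v *)
Require Import Defs.
From HB Require Import structures.
From mathcomp Require Import all_boot all_order all_algebra.
From mathcomp Require Import monalg.
From mathcomp Require Import mpoly.

Set Implicit Arguments.
Unset Strict Implicit.
Unset Printing Implicit Defensive.

Import GRing.Theory.
Local Open Scope ring_scope.

(* Modulo R_3 the anticommutators {e_i, e_j} are central, so every tensor is
   congruent to a sum of terms p_I e_I, where the word e_I is strictly
   increasing and p_I is a polynomial in the {e_i, e_j} / 2. The map to B sends
   {e_i, e_j} / 2 to the coordinate q(e_i, e_j), and e_I to the wedge product
   over I plus lower terms; since the q(e_i, e_j), i <= j, are algebraically
   independent, a normal form in the kernel has all its p_I equal to 0. *)

(** * Monoid algebras of free monoids *)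

(** Right multiplication by a constant is also scaling, because the unit monomial is right neutral
    and coefficients commute. *)
Lemma malg_scaleAr (M : monomType) (R : comNzRingType) (c : R)
    (x y : {malg R[M]}) : c *: (x * y) = x * (c *: y).
Proof.
suff h : x * @malgC M R c = c *: x.
  by rewrite -[c *: y]mul_malgC mulrA h scalerAl.
rewrite malgM_def fgmulgU malgZ_def.
by apply: eq_bigr => m _; rewrite monalg.mulm1 mulrC.
Qed.

Lemma malgUE (M : choiceType) (R : comNzRingType) (c : R) (m : M) :
  << c *g m >> = c *: << m >> :> {malg R[M]}.
Proof. by apply/malgP=> l; rewrite monalg.mcoeffZ !mcoeffU mulrnAr mulr1. Qed.

Lemma malgU_fmonom_cons (I : choiceType) (R : comNzRingType) (i : I) (s : seq I) :
  << FMonom (i :: s) >> = << fmu i >> * << FMonom s >> :> {malg R[{fmonom I}]}.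
Proof.
rewrite malgM_def fgmulUU mulr1; congr mkmalgU.
by apply: val_inj; rewrite /= fmM fmU.
Qed.

Lemma malgU_fmonom_nil (I : choiceType) (R : comNzRingType) :
  << FMonom [::] >> = 1 :> {malg R[{fmonom I}]}.
Proof. by congr mkmalgU; apply: val_inj; rewrite /= fm1. Qed.

(** * Two-sided ideals and commutation modulo an ideal *)

Section TwoSidedIdeal.
Context (A : pzRingType) (J : A -> Prop) (idealJ : two_sided_ideal J).
Implicit Types x y z : A.

Lemma ideal0 : J 0. Proof. by case: idealJ. Qed.

Lemma idealB x y : J x -> J y -> J (x - y).
Proof. by case: idealJ => _ h _; exact: h. Qed.

Lemma idealN x : J x -> J (- x).
Proof. by move=> Jx; rewrite -[- x]add0r; exact: idealB ideal0 Jx. Qed.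

Lemma idealD x y : J x -> J y -> J (x + y).
Proof. by move=> Jx Jy; rewrite -[y]opprK; apply/idealB/idealN. Qed.

Lemma idealMl x y : J y -> J (x * y).
Proof. by case: idealJ => _ _ h Jy; rewrite -[x * y]mulr1; exact: h. Qed.

Lemma idealMr x y : J x -> J (x * y).
Proof. by case: idealJ => _ _ h Jx; rewrite -[x * y]mul1r mulrA; exact: h. Qed.

Lemma ideal_trans y x z : J (x - y) -> J (y - z) -> J (x - z).
Proof. by move=> Jxy /(idealD Jxy); rewrite addrA subrK. Qed.

Lemma ideal_congrD x y x' y' : J (x - x') -> J (y - y') -> J (x + y - (x' + y')).
Proof. by move=> Jx /(idealD Jx); rewrite addrACA -opprD. Qed.

Definition commute_mod x y := J (x * y - y * x).

Lemma commute_mod_sym x y : commute_mod x y -> commute_mod y x.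
Proof. by move/idealN; rewrite opprB. Qed.

Lemma commute_mod0 x : commute_mod x 0.
Proof. by rewrite /commute_mod mulr0 mul0r subrr; exact: ideal0. Qed.

Lemma commute_mod1 x : commute_mod x 1.
Proof. by rewrite /commute_mod mulr1 mul1r subrr; exact: ideal0. Qed.

Lemma commute_modM x y z :
  commute_mod x y -> commute_mod x z -> commute_mod x (y * z).
Proof.
move=> /(idealMr z); rewrite mulrBl => Jy /(idealMl y); rewrite mulrBr => Jz.
by rewrite /commute_mod mulrA; apply: ideal_trans Jy _; move: Jz; rewrite !mulrA.
Qed.

Lemma commute_modX x y m : commute_mod x y -> commute_mod x (y ^+ m).
Proof.
move=> cxy; elim: m => [|m IH]; first exact: commute_mod1.
by rewrite exprS; exact: commute_modM.
Qed.

Lemma commute_modD x y z :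
  commute_mod x y -> commute_mod x z -> commute_mod x (y + z).
Proof. by rewrite /commute_mod mulrDr mulrDl; exact: ideal_congrD. Qed.

(** The factor [g a] is moved to the right, past powers it commutes with modulo [J], until it meets
    its own power. This is monomial multiplication for variables that commute only modulo [J]. *)
Lemma prod_expr_mod (I : eqType) (g : I -> A) (a : I) (m : I -> nat) (r : seq I) :
  (forall b, commute_mod (g a) (g b)) -> uniq r -> a \in r ->
  J (g a * \prod_(b <- r) g b ^+ m b - \prod_(b <- r) g b ^+ ((a == b) + m b)).
Proof.
move=> ga; elim: r => //= b r IH /andP[br ur]; rewrite inE !big_cons mulrA.
have [ab _|ab /= ar] := eqVneq a b.
  rewrite -{}ab in br *; rewrite -exprS [X in _ - _ * X](_ : _ = \prod_(c <- r) g c ^+ m c).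
    by rewrite subrr; exact: ideal0.
  rewrite !big_seq; apply: eq_bigr => c cr.
  by case: eqP cr br => // <- ->.
have := idealMr (\prod_(c <- r) g c ^+ m c) (commute_modX (m b) (ga b)).
rewrite mulrBl => /ideal_trans; apply; rewrite add0n -!mulrA -mulrBr.
exact/idealMl/IH.
Qed.

End TwoSidedIdeal.

Lemma generated_ideal_ideal (A : pzRingType) (S : A -> Prop) :
  two_sided_ideal (generated_ideal S).
Proof.
split=> [J idJ _|x y hx hy J idJ SJ|a x b hx J idJ SJ].
- exact: ideal0.
- by apply: idealB; [|exact: hx|exact: hy].
- by case: (idJ) => _ _; apply; exact: hx.
Qed.

Lemma mem_generated_ideal (A : pzRingType) (S : A -> Prop) x :
  S x -> generated_ideal S x.
Proof. by move=> Sx J _; apply. Qed.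

Section AlgebraIdeal.
Context (k : comNzRingType) (T : algType k).
Context (J : T -> Prop) (idealJ : two_sided_ideal J).
Implicit Types (c : k) (t u : T).

Lemma idealZ c t : J t -> J (c *: t).
Proof. by move=> Jt; rewrite -mulr_algl; exact: idealMl. Qed.

Lemma commute_modZl c t u : commute_mod J t u -> commute_mod J (c *: t) u.
Proof.
by rewrite /commute_mod -scalerAl -scalerAr -scalerBr; exact: idealZ.
Qed.

Lemma commute_modZr c t u : commute_mod J t u -> commute_mod J t (c *: u).
Proof.
by rewrite /commute_mod -scalerAl -scalerAr -scalerBr; exact: idealZ.
Qed.

End AlgebraIdeal.

(** * Unordered pairs of indices and their representatives *)

Section Sym2Index.
Context (n : nat).
Implicit Types (i j : 'I_n) (A : sym2_index n).

Lemma sym2_pairC i j : sym2_pair i j = sym2_pair j i.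
Proof. by apply: val_inj; rewrite /= setUC. Qed.

Lemma sym2_pair_inj i j i' j' : sym2_pair i j = sym2_pair i' j' ->
  (i = i' /\ j = j') \/ (i = j' /\ j = i').
Proof.
move/(congr1 val) => /= /setP e.
have := e i; have := e j; have := e i'; have := e j'; rewrite !inE !eqxx ?orbT.
move=> /pred2P ej' /pred2P ei' /esym/pred2P ej /esym/pred2P ei.
case: ei => Ei; [left|right]; split=> //; case: ej; case: ej'; case: ei'; congruence.
Qed.

Lemma sym2_pair_surj A : exists p : 'I_n * 'I_n, sym2_pair p.1 p.2 == A.
Proof.
case/andP: (valP A) => /card_gt0P[i iA] leA.
suff [j jA] : exists j, val A = [set i; j] by exists (i, j); apply/eqP/val_inj.
(* Removing [i] leaves at most one element; if it leaves none, the pair is {i, i}. *)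
have := leA; rewrite (cardsD1 i) iA add1n ltnS leq_eqVlt ltnS leqn0.
case/orP => [/cards1P[j Aj]|/eqP/cards0_eq A0]; [exists j|exists i].
  by rewrite -Aj setD1K.
by rewrite setUid -[LHS](setD1K iA) A0 setU0.
Qed.

Definition sym2_rep A := xchoose (sym2_pair_surj A).

Lemma sym2_repP A : sym2_pair (sym2_rep A).1 (sym2_rep A).2 = A.
Proof. exact/eqP/(xchooseP (sym2_pair_surj A)). Qed.

End Sym2Index.

(** * Anticommutators *)

Definition anticomm (A : pzRingType) (x y : A) := x * y + y * x.

(** The right-hand side is the shape of a cubic relation: R_3 thus says that anticommutators of
    vectors commute with vectors. *)
Lemma commutator_anticomm (A : pzRingType) (x y z : A) :
  anticomm x y * z - z * anticomm x y =
  x * y * z + y * x * z - z * y * x - z * x * y.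
Proof. by rewrite /anticomm mulrDl mulrDr opprD addrA !mulrA addrAC. Qed.

Lemma anticomm_sum (k : comNzRingType) (T : algType k) (I : finType)
    (x : I -> T) (c d : I -> k) :
  anticomm (\sum_i c i *: x i) (\sum_j d j *: x j) =
  \sum_i \sum_j (c i * d j) *: anticomm (x i) (x j).
Proof.
rewrite /anticomm mulr_suml mulr_sumr -big_split; apply: eq_bigr => i _ /=.
rewrite mulr_sumr mulr_suml -big_split; apply: eq_bigr => j _ /=.
by rewrite -!scalerAl -!scalerAr !scalerA scalerDr [X in _ + X *: _]mulrC.
Qed.

(** * Normal forms modulo central anticommutators *)

Section CentralAnticommutators.
Context (k : fieldType) (char0 : [pchar k] =i pred0) (n : nat).
Context (T : algType k) (x : 'I_n -> T).
Local Notation N := #|{: sym2_index n}|.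
Local Notation P := (mpoly N k).
Implicit Types (i j l : 'I_n) (a b : 'I_N) (s : seq 'I_n) (t u : T) (p : P).

Lemma two_neq0 : 2%:R != 0 :> k.
Proof. by have /pcharf0P -> := char0. Qed.

(** This lifts a coordinate of P(Sym^2 V^dual): in the Clifford algebra e_i e_j + e_j e_i = 2 q(e_i,
    e_j), hence the factor 1/2. The order of the chosen representative is irrelevant, as the
    anticommutator is symmetric. *)
Definition sym2_var a : T :=
  let ij := sym2_rep (enum_val a) in 2%:R^-1 *: anticomm (x ij.1) (x ij.2).
Local Notation z := sym2_var.

Lemma anticomm_sym2_var i j :
  anticomm (x i) (x j) = 2%:R *: z (enum_rank (sym2_pair i j)).
Proof.
rewrite /z enum_rankK scalerA divff ?two_neq0 // scale1r.
have := sym2_pair_inj (sym2_repP (sym2_pair i j)); move: (sym2_rep _) => ij.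
by case=> -[-> ->] //; rewrite /anticomm addrC.
Qed.

Lemma sqr_sym2_var i : x i * x i = z (enum_rank (sym2_pair i i)).
Proof.
have := anticomm_sym2_var i i; rewrite /anticomm -mulr2n -scaler_nat.
exact: (scalerI two_neq0).
Qed.

Definition sym2_poly p : T := mmap (in_alg T) z p.
Local Notation zeta := sym2_poly.

Lemma sym2_polyD p q : zeta (p + q) = zeta p + zeta q.
Proof. exact: raddfD. Qed.

Lemma sym2_polyZX c (m : 'X_{1..N}) : zeta (c *: 'X_[m]) = c *: mmap1 z m.
Proof. by rewrite /zeta mmapZ mmapX /= mulr_algl. Qed.

Section NormalForm.
Context (J : T -> Prop) (idealJ : two_sided_ideal J).
Context (central : forall i j l, commute_mod J (anticomm (x i) (x j)) (x l)).

Lemma commute_mod_var a l : commute_mod J (z a) (x l).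
Proof. exact/(commute_modZl idealJ). Qed.

Lemma commute_mod_vars a b : commute_mod J (z a) (z b).
Proof.
apply: (commute_modZr idealJ).
by apply: commute_modD => //; apply: commute_modM => //; exact: commute_mod_var.
Qed.

(** The [z b] commute only modulo [J], so [zeta] need not be multiplicative in [T]; this recovers
    modulo [J] the multiplicativity that is used. *)
Lemma sym2_polyX a p : J (z a * zeta p - zeta ('X_a * p)).
Proof.
elim/mpolyind: p => [|c m p _ _ IH].
  by rewrite mulr0 /zeta raddf0 mulr0 subrr; exact: ideal0.
rewrite mulrDr !sym2_polyD mulrDr; apply: ideal_congrD IH => //.
rewrite -scalerAr -mpolyXD !sym2_polyZX -scalerAr -scalerBr; apply: (idealZ idealJ).
rewrite /mmap1.
have := prod_expr_mod idealJ m (commute_mod_vars a) (index_enum_uniq _) (mem_index_enum a).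
by under [X in _ - X]eq_bigr => b _ do rewrite -mnm1E -mnmDE.
Qed.

(* s lists the generators that may still occur in the words e_I. *)
Fixpoint normal_form s t : Prop :=
  if s is i :: s' then exists u v,
    [/\ normal_form s' u, normal_form s' v & J (t - (u + x i * v))]
  else exists p, J (t - zeta p).
Local Notation NF := normal_form.

Lemma normal_formD s t u : NF s t -> NF s u -> NF s (t + u).
Proof.
elim: s t u => [|i s IH] t u /=.
  move=> [p Jp] [q Jq]; exists (p + q); rewrite sym2_polyD.
  exact: ideal_congrD.
move=> [t0 [t1 [h0 h1 Jt]]] [u0 [u1 [g0 g1 Ju]]].
exists (t0 + u0), (t1 + u1); split; [exact: IH|exact: IH|].
by rewrite mulrDr addrACA; exact: ideal_congrD.
Qed.

Lemma normal_formZ s c t : NF s t -> NF s (c *: t).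
Proof.
elim: s t => [|i s IH] t /=.
  move=> [p Jp]; exists (c *: p); rewrite /zeta mmapZ /= mulr_algl -scalerBr.
  exact: idealZ.
move=> [t0 [t1 [h0 h1 Jt]]]; exists (c *: t0), (c *: t1).
by split; [exact: IH|exact: IH|]; rewrite -scalerAr -scalerDr -scalerBr; exact: idealZ.
Qed.

Lemma normal_form0 s : NF s 0.
Proof.
elim: s => [|i s IH] /=.
  by exists 0; rewrite /zeta raddf0 subrr; exact: ideal0.
by exists 0, 0; split=> //; rewrite mulr0 addr0 subrr; exact: ideal0.
Qed.

Lemma normal_form1 s : NF s 1.
Proof.
elim: s => [|i s IH] /=.
  by exists 1%:MP; rewrite /zeta mmapC /= scale1r subrr; exact: ideal0.
exists 1, 0; split=> //; first exact: normal_form0.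
by rewrite mulr0 addr0 subrr; exact: ideal0.
Qed.

(** Being central modulo [J], [z a] passes every generator and reaches the polynomial
    coefficients. *)
Lemma normal_form_var s a t : NF s t -> NF s (z a * t).
Proof.
elim: s t => [|i s IH] t /=.
  move=> [p /(idealMl idealJ (z a))]; rewrite mulrBr => Jp; exists ('X_a * p).
  exact: ideal_trans Jp (sym2_polyX _ _).
move=> [t0 [t1 [h0 h1 /(idealMl idealJ (z a)) Jt]]].
exists (z a * t0), (z a * t1); split; [exact: IH|exact: IH|].
move: Jt; rewrite mulrBr => /ideal_trans; apply=> //.
rewrite mulrDr; apply: ideal_congrD; first exact: idealJ.
  by rewrite subrr; exact: ideal0.
by rewrite !mulrA -mulrBl; apply: idealMr => //; exact: commute_mod_var.
Qed.

(** The straightening step: [x j] is moved past the smaller generators with x_j x_i = 2 z_ij - x_i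
    x_j until it meets its own place. *)
Lemma normal_form_gen s j t : j \in s -> NF s t -> NF s (x j * t).
Proof.
elim: s t => [//|i s IH] t js /= [t0 [t1 [h0 h1 /(idealMl idealJ (x j))]]].
rewrite mulrBr mulrDr mulrA => Jt.
have [ji|ji] := eqVneq j i.
  (* Here x_i (t0 + x_i t1) = z_ii t1 + x_i t0, so the two components trade places. *)
  exists (z (enum_rank (sym2_pair i i)) * t1), t0; split=> //.
    exact: normal_form_var.
  by move: Jt; rewrite ji sqr_sym2_var [X in _ - X]addrC.
have {}js : j \in s by move: js; rewrite inE (negPf ji).
(* Here x_j (t0 + x_i t1) = (x_j t0 + 2 z_ij t1) - x_i (x_j t1). *)
exists (x j * t0 + 2%:R *: (z (enum_rank (sym2_pair j i)) * t1)), (- (x j * t1)); split.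
- by apply: normal_formD; [exact: IH|exact/normal_formZ/normal_form_var].
- by rewrite -scaleN1r; exact/normal_formZ/IH.
rewrite scalerAl -anticomm_sym2_var /anticomm mulrN mulrA -addrA.
by rewrite -mulrBl addrK.
Qed.

(** * Evaluation of normal forms in the Clifford algebra *)

Section Evaluation.
Context (F : comNzRingType) (iota : {rmorphism P -> F}).
Context (q : 'I_n -> 'I_n -> F) (ev : T -> ext F n).
Context (qE : forall i j, q i j = iota 'X_(enum_rank (sym2_pair i j))).
Context (evD : {morph ev : t u / t + u}).
Context (evZ : forall c t, ev (c *: t) = iota c%:MP *: ev t).
Context (ev1 : ev 1 = ext_basis set0).
Context (ev_gen : forall i t, ev (x i * t) = cliff_gen q i (ev t)).

Lemma eval_anticommM i j t :
  ev (anticomm (x i) (x j) * t) = (q i j + q j i) *: ev t.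
Proof. by rewrite mulrDl evD -!mulrA !ev_gen cliff_gen_anti addrNK. Qed.

(** An anticommutator evaluates to a scalar multiple of the unit, which is central. This gives the
    cubic relations in the kernel. *)
Lemma eval_commutator_anticomm i j t :
    (forall u v, ev (u * v) = cliff_mul q (ev u) (ev v)) ->
  ev (t * anticomm (x i) (x j) - anticomm (x i) (x j) * t) = 0.
Proof.
move=> evM; have evN u : ev (- u) = - ev u.
  by rewrite -scaleN1r evZ !rmorphN1 scaleN1r.
rewrite evD evN eval_anticommM evM -[anticomm _ _]mulr1 eval_anticommM.
by rewrite cliff_mulZr ev1 cliff_mul1r subrr.
Qed.

(** Both orders of a pair give the same coordinate, so q_ij + q_ji = 2 q_ij and the factor 1/2
    cancels. *)
Lemma eval_sym2_varM a t : ev (z a * t) = iota 'X_a *: ev t.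
Proof.
rewrite /z -scalerAl evZ eval_anticommM !qE.
rewrite (sym2_pairC (sym2_rep _).2) sym2_repP scalerA; congr (_ *: _).
rewrite enum_valK -rmorphD -rmorphM mul_mpolyC.
by rewrite -mulr2n -scaler_nat scalerA mulVf ?two_neq0 // scale1r.
Qed.

Lemma eval_mmap1 (m : 'X_{1..N}) :
  ev (mmap1 z m) = iota 'X_[m] *: ext_basis set0.
Proof.
rewrite mpolyXE_id /mmap1; elim: (index_enum _) => [|a r IH].
  by rewrite !big_nil rmorph1 scale1r ev1.
rewrite !big_cons rmorphM -scalerA -IH; move: (\prod_(_ <- _) _) => t.
elim: (m a) => [|d IHd]; first by rewrite mul1r rmorph1 scale1r.
by rewrite !exprS -mulrA eval_sym2_varM IHd scalerA -rmorphM.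
Qed.

Lemma eval_sym2_poly p : ev (zeta p) = iota p *: ext_basis set0.
Proof.
elim/mpolyind: p => [|c m p _ _ IH].
  (* Zero is written as a scalar multiple so that [evZ] yields its value. *)
  have -> : zeta 0 = 0 *: 0 by rewrite scale0r /zeta raddf0.
  by rewrite evZ !rmorph0 !scale0r.
rewrite sym2_polyD evD IH sym2_polyZX evZ eval_mmap1.
by rewrite rmorphD scalerDl -mul_mpolyC rmorphM scalerA.
Qed.

Context (iota_inj : injective iota) (evJ : forall t, J t -> ev t = 0).

Lemma eval_mod t u : J (t - u) -> ev t = ev u.
Proof. by move/evJ => e; rewrite -[t](subrK u) evD e add0r. Qed.

(** Polynomials evaluate to multiples of the unit, and [cliff_gen q i] introduces no basis vector
    outside a support that contains [i]. *)
Lemma supp_normal_form s t : NF s t -> supp s (ev t).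
Proof.
elim: s t => [|i s IH] t /=.
  case=> p /eval_mod -> l _; rewrite eval_sym2_poly.
  by rewrite linearZ /= ext_del1 scaler0.
case=> u [v [/IH su /IH sv /eval_mod ->]] l ls.
have sub h : supp s (ev h) -> supp (i :: s) (ev h).
  by move=> sh m; rewrite inE negb_or => /andP[_]; exact: sh.
by rewrite evD ev_gen linearD /= (sub _ su) // (supp_gen _ (sub _ sv)) ?mem_head ?addr0.
Qed.

(* The component v of t = u + x_i v is isolated by the interior product with
   the i-th dual basis vector, as u and v evaluate to elements free of e_i. *)
Lemma normal_form_eval_eq0 s t : uniq s -> NF s t -> ev t = 0 -> J t.
Proof.
elim: s t => [|i s IH] t /= => [_ [p Jtp]|/andP[is_ us] [u [v [hu hv Jt]]]] et.
  (* The coefficient on the empty wedge is [iota p], so injectivity of [iota] forces p = 0. *)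
  have := eval_mod Jtp; rewrite et eval_sym2_poly.
  move/ffunP/(_ set0)/esym/eqP; rewrite !ffunE eqxx /GRing.scale /= mulr1.
  rewrite -(rmorph0 iota) (inj_eq iota_inj) => /eqP p0.
  by move: Jtp; rewrite p0 /zeta raddf0 subr0.
have e : ev u + cliff_gen q i (ev v) = 0 by rewrite -ev_gen -evD -(eval_mod Jt).
have v0 : ev v = 0.
  have /(congr1 (ext_del i)) := e; rewrite linear0 linearD /= cliff_gen_del.
  rewrite (supp_normal_form hu is_) (supp_normal_form hv is_) linear0.
  by rewrite eqxx scale1r subr0 add0r.
have u0 : ev u = 0 by move: e; rewrite v0 linear0 addr0.
rewrite -[t](subrK (u + x i * v)); apply: (idealD idealJ Jt).
by apply: (idealD idealJ); [exact: IH|exact/(idealMl idealJ)/IH].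
Qed.

End Evaluation.
End NormalForm.
End CentralAnticommutators.

(** * The tensor algebra and the kernel of its map to B *)

Section TensorAlgebra.
Context (k : fieldType) (V : vectType k).
Local Notation n := (\dim {:V}).
Local Notation T := (tensor_algebra V).
Local Notation K := (generated_ideal (@R3 k V)).
Implicit Types (i j l : 'I_n) (t u : T) (v w : V).

HB.instance Definition _ :=
  GRing.Lalgebra_isAlgebra.Build k T (@malg_scaleAr {fmonom 'I_n} k).

Definition tensor_var i : T := mkmalgU (fmu i) 1.
Local Notation X := tensor_var.

Lemma tensor_incl_basis i : tensor_incl (vbasis {:V})`_i = X i.
Proof.
rewrite /tensor_incl (bigD1 i) //= big1 ?addr0.
  by rewrite coord_free ?eqxx ?scale1r // (basis_free (vbasisP _)).
move=> j /negPf ji; rewrite coord_free ?(basis_free (vbasisP _)) //.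
by rewrite [i == j]eq_sym ji scale0r.
Qed.

Lemma cubic_relationE v1 v2 v3 : cubic_relation v1 v2 v3 =
  anticomm (tensor_incl v1) (tensor_incl v2) * tensor_incl v3
  - tensor_incl v3 * anticomm (tensor_incl v1) (tensor_incl v2).
Proof. by rewrite commutator_anticomm. Qed.

(** The embedding into the function field, retyped on plain polynomials so as to serve as [iota]. *)
Definition tofrac_mpoly :
    {rmorphism mpoly #|{: sym2_index n}| k -> fun_field k n} :=
  @FracField.tofrac (coord_ring k n).

Lemma tofrac_mpoly_inj : injective tofrac_mpoly.
Proof. by move=> p q /eqP; rewrite tofrac_eq => /eqP. Qed.

(** Forgetting membership in B gives access to the interior products of the exterior algebra. *)
Definition tensor_eval t : ext (fun_field k n) n := val (tensor_to_coord t).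
Local Notation ev := tensor_eval.

Lemma tensor_evalD t u : ev (t + u) = ev t + ev u.
Proof. by rewrite /ev raddfD. Qed.

Lemma tensor_evalZ c t : ev (c *: t) = const_frac n c *: ev t.
Proof. by rewrite /ev linearZ. Qed.

Lemma tensor_eval1 : ev 1 = ext_basis set0.
Proof. by rewrite /ev rmorph1. Qed.

Lemma tensor_eval_varM i t : ev (X i * t) = cliff_gen (@q_taut k n) i (ev t).
Proof.
rewrite /ev rmorphM /= -[RHS]cliff_mul_basis1 /X.
by rewrite /tensor_to_coord monalg.mmapU /= scale1r mul1r /word_prod fmU big_seq1.
Qed.

Lemma tensor_evalM t u : ev (t * u) = cliff_mul (@q_taut k n) (ev t) (ev u).
Proof. by rewrite /ev rmorphM. Qed.

Lemma tensor_eval_eq0 t : ev t = 0 <-> tensor_to_coord t = 0.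
Proof.
rewrite /ev; split=> [h|h]; last by rewrite h.
exact: val_inj.
Qed.

Definition tensor_ker t := tensor_to_coord t = 0.
Local Notation ker := tensor_ker.

Lemma tensor_ker_ideal : two_sided_ideal ker.
Proof.
rewrite /ker; split=> [|t u ht hu|t u w hu]; first exact: raddf0.
  by rewrite raddfB /= ht hu subr0.
by rewrite !rmorphM /= hu mulr0 mul0r.
Qed.

Lemma tensor_ker_anticomm i j t :
  commute_mod ker t (anticomm (X i) (X j)).
Proof.
apply/tensor_eval_eq0.
exact: (eval_commutator_anticomm (iota := tofrac_mpoly) tensor_evalD tensor_evalZ
  tensor_eval1 tensor_eval_varM _ _ _ tensor_evalM).
Qed.

(** By bilinearity the anticommutator of two vectors is a combination of those of generators, each
    central modulo the kernel. *)
Lemma tensor_ker_cubic v1 v2 v3 : ker (cubic_relation v1 v2 v3).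
Proof.
rewrite cubic_relationE; apply: (commute_mod_sym tensor_ker_ideal).
rewrite anticomm_sum; have kerI := tensor_ker_ideal.
elim/big_ind: _ => [|u w|i _]; [exact: commute_mod0|exact: commute_modD|].
elim/big_ind: _ => [|u w|j _]; [exact: commute_mod0|exact: commute_modD|].
exact/(commute_modZr kerI)/tensor_ker_anticomm.
Qed.

Lemma tensor_ker_generated t : K t -> ker t.
Proof.
apply; first exact: tensor_ker_ideal.
move=> _ [s ->]; have kerI := tensor_ker_ideal.
elim/big_ind: _ => [|u w|c _]; [exact: raddf0|exact: (idealD kerI)|].
exact/(idealZ kerI)/tensor_ker_cubic.
Qed.

Lemma generated_anticomm i j l : commute_mod K (anticomm (X i) (X j)) (X l).
Proof.
apply: mem_generated_ideal; pose b := vbasis {:V}.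
(* A single cubic relation, on three basis vectors, is this commutator. *)
exists [:: (1, (b`_i, b`_j, b`_l))].
by rewrite big_seq1 /= scale1r cubic_relationE !tensor_incl_basis.
Qed.

(** Each word is built from the unit by left multiplication by generators, and each such step
    preserves normal forms. *)
Lemma tensor_normal_form t : [pchar k] =i pred0 -> normal_form X K (enum 'I_n) t.
Proof.
move=> char0; have idK := generated_ideal_ideal (@R3 k V).
rewrite [t]monalgE; elim/big_ind: _ => [|u w|[s] _].
- exact: normal_form0.
- exact: normal_formD.
rewrite malgUE; apply: (normal_formZ idK); elim: s => [|i s IH].
  by rewrite malgU_fmonom_nil; exact: normal_form1.
rewrite malgU_fmonom_cons.
apply: (normal_form_gen char0 idK generated_anticomm) => //.
by rewrite mem_enum.
Qed.

End TensorAlgebra.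

Theorem corollary3p11 (k : fieldType) (char0 : [pchar k] =i pred0)
    (V : vectType k) (n : nat) (n_ge1 : (1 <= n)%N) (dimV : \dim {:V} = n)
    (t : tensor_algebra V) :
  tensor_to_coord t = 0 <-> generated_ideal (@R3 k V) t.
Proof.
split=> [t0|]; last exact: tensor_ker_generated.
(* The entries of [q_taut] are coordinates by definition, whence [erefl]; evaluation kills the ideal
   by the converse inclusion. *)
apply: (normal_form_eval_eq0 char0 (generated_ideal_ideal (@R3 k V))
  (fun _ _ => erefl) (@tensor_evalD k V) (@tensor_evalZ k V)
  (@tensor_eval1 k V) (@tensor_eval_varM k V) (@tofrac_mpoly_inj k V) _
  (enum_uniq 'I_(\dim {:V})) (tensor_normal_form t char0)).
- by move=> u Ku; apply/tensor_eval_eq0/tensor_ker_generated.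
- exact/tensor_eval_eq0.
Qed.
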